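(* Let $\lambda=2^{5/2}$ and consider the system $$\frac{d a_j}{dt}=\lambda^{j-1}a_{j-1}^2-\lambda^{j}a_ja_{j+1}+f_j\quad (j>0),\qquad \frac{d a_0}{dt}=-a_0a_1+f_0,$$ with $f=(f_0,f_1,f_2,\dots)=(\lambda^{-1/3},0,0,\dots)$. Then every solution of this system blows up in finite time in the $H^{5/6}$-norm. More precisely, for every solution $a(t)$ on $[0,\infty)$ with $a(0)\in l^2$, writing $b_j(0)=a_j(0)-\lambda^{-j/3}$ and $b(0)=\{b_j(0)\}_{j\ge0}$, there exists a time $t^*$ with $$0\le t^*\le 2\lambda^{\frac13}\|b(0)\|_{l^2}$$ such that $$\limsup_{t\to t^*}\|a(t)\|_{H^{5/6}}=\infty .$$
   Context: Sequences are real and indexed by $j=0,1,2,\dots$, with norms $\|a\|_{l^2}=\big(\sum_{j\ge0}a_j^2\big)^{1/2}$ and $\|a\|_{H^{s}}=\big(\sum_{j\ge 0}2^{2sj}a_j^2\big)^{1/2}$ (with value $+\infty$ if the series diverges). A solution on $[0,\infty)$ is an $l^2$-valued function $a(t)=(a_0(t),a_1(t),\dots)$ defined for $t\in[0,\infty)$ such that $a_j\in C^1([0,\infty))$ and $a_j(t)$ satisfies the system on $(0,\infty)$ for all $j$. The limsup is taken over $t\ge 0$, $t\to t^*$. *)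

(* Defs.v *)
From HB Require Import structures.
From mathcomp Require Import all_boot all_order all_algebra.
From mathcomp Require Import all_classical all_reals all_analysis.

Set Implicit Arguments.
Unset Strict Implicit.
Unset Printing Implicit Defensive.

Import Order.TTheory GRing.Theory Num.Theory.
Import numFieldNormedType.Exports.

Local Open Scope classical_set_scope.
Local Open Scope ring_scope.

(* Norms take values in \bar R, a divergent series giving +oo. *)
Definition l2norm (R : realType) (a : nat -> R) : \bar R :=
  ((\sum_(0 <= j <oo) ((a j) ^+ 2)%:E) `^ (2^-1))%E.

Definition Hnorm (R : realType) (s : R) (a : nat -> R) : \bar R :=
  ((\sum_(0 <= j <oo) (2 `^ (2 * s * j%:R) * (a j) ^+ 2)%:E) `^ (2^-1))%E.

Definition in_l2 (R : realType) (a : nat -> R) : Prop := (l2norm a < +oo)%E.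

(* u is C^1 on [0, +oo), with a one-sided derivative at 0; the values of u on
   negative reals play no role. *)
Definition C1_nonneg (R : realType) (u : R -> R) : Prop :=
  exists v : R -> R,
    [/\ {within `[0, +oo[, continuous v},
        forall t : R, 0 < t -> is_derive t 1 u (v t) &
        (u t - u 0) / t @[t --> 0^'+] --> v 0].

Definition dyadic_rhs (R : realType) (lam : R) (f a : nat -> R) (j : nat) : R :=
  match j with
  | 0%N => - (a 0%N * a 1%N) + f 0%N
  | i.+1 => lam ^+ i * a i ^+ 2 - lam ^+ i.+1 * a i.+1 * a i.+2 + f i.+1
  end.

(* Solutions are total functions of t : R, constrained only for t >= 0. *)
Definition is_solution (R : realType) (lam : R) (f : nat -> R)
    (a : R -> nat -> R) : Prop :=
  [/\ forall t : R, 0 <= t -> in_l2 (a t),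
      forall j : nat, C1_nonneg (fun t => a t j) &
      forall (j : nat) (t : R), 0 < t ->
        is_derive t 1 (fun t => a t j) (dyadic_rhs lam f (a t) j)].

Definition lambda (R : realType) : R := 2 `^ (5 / 2).

Definition forcing (R : realType) (j : nat) : R :=
  if j is 0%N then lambda R `^ (- (1 / 3)) else 0.

(* limsup of g(t) as t -> t0, t <> t0, t ranging over [0, +oo). *)
Definition limsup_nonneg (R : realType) (g : R -> \bar R) (t0 : R) : \bar R :=
  limf_esup g (within `[0, +oo[ t0^').

(* Main.v *)
(* Put k = lambda^(-1/3), c_j = k^(-j) a_j and b_j = a_j - k^j; the fixed point
   is c = 1, and the H^(5/6) norm of a is the l^2 norm of c. Suppose that it has
   finite limsup at every time of [0, T], with T = 2 ||b(0)|| / k. By compactness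
   and lower semicontinuity it is bounded on [0, T]. Summation by parts in the
   energy of b, truncated at mode n, gives
     y_n' = k (- 1 - (c_0 - 1)^2 - sum_(j < n) (c_j - c_(j+1))^2 + flux_n),
   with y_n = sum_(j <= n) b_j^2. Since k^2 <= 1/3, the two sums of squares
   dominate y_n / 4, and sum_n flux_n is bounded. Averaging over n therefore
   leaves Y' <= k (- 1 - Y / 4) + o(1), while 1 + Y / 4 >= sqrt Y, so that b
   vanishes at time T. Then c(T) = 1 and a(T) has infinite H^(5/6) norm. *)
Require Import Defs.
From HB Require Import structures.
From mathcomp Require Import all_boot all_order all_algebra.
From mathcomp Require Import all_classical all_reals all_analysis.
From mathcomp Require Import ring lra.

Import Order.TTheory GRing.Theory Num.Theory.
Import numFieldNormedType.Exports.

Local Open Scope classical_set_scope.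
Local Open Scope ring_scope.

(** * Energy balance of the truncated system *)

(* Up to the factor k, the boundary term left at mode n by the summations by
   parts in [energy_identity]. *)
Definition flux {R : realType} (c : nat -> R) (n : nat) : R :=
  c n ^+ 2 + 2 * c n * c n.+1 - 2 * c n ^+ 2 * c n.+1.

(** Since [lam * k ^+ 3 = 1], mode [n.+1] contributes [2 * k * (c n.+1 - 1) * (c n ^+ 2 - c n.+1 * c
    n.+2)], which is [k] times [flux c n.+1 - flux c n - (c n - c n.+1) ^+ 2], so the fluxes
    telescope. *)
Lemma energy_identity {R : realType} (k lam : R) (f a c : nat -> R) (n : nat) :
    lam * k ^+ 3 = 1 -> f 0%N = k -> (forall j, f j.+1 = 0) ->
    (forall j, a j = k ^+ j * c j) ->
  \sum_(j < n.+1) 2 * (a j - k ^+ j) * dyadic_rhs lam f a j =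
  k * (- 1 - (c 0%N - 1) ^+ 2 - \sum_(j < n) (c j - c j.+1) ^+ 2 + flux c n).
Proof.
move=> lk f0 fS ac; elim: n => [|n IHn].
  rewrite big_ord_recr !big_ord0 /= /flux f0 !ac expr0 expr1; ring.
rewrite big_ord_recr /= IHn [in RHS]big_ord_recr /= fS !ac /flux addr0.
have q1 : lam ^+ n * (k ^+ n) ^+ 3 = 1.
  by rewrite -exprM mulnC exprM -exprMn lk expr1n.
have -> : 2 * (k ^+ n.+1 * c n.+1 - k ^+ n.+1) *
    (lam ^+ n * (k ^+ n * c n) ^+ 2 -
     lam ^+ n.+1 * (k ^+ n.+1 * c n.+1) * (k ^+ n.+2 * c n.+2)) =
    2 * k * (c n.+1 - 1) * ((lam ^+ n * (k ^+ n) ^+ 3) * c n ^+ 2 -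
      (lam * k ^+ 3) * (lam ^+ n * (k ^+ n) ^+ 3) * c n.+1 * c n.+2).
  by rewrite !exprS; ring.
by rewrite q1 lk; ring.
Qed.

(** A discrete Hardy inequality, used with [d j = c j - 1]: the geometric weights pay for reaching
    [d j] from [d 0] through its increments. *)
Lemma weighted_sum_le {R : realType} (k : R) (d : nat -> R) (n : nat) :
    k ^+ 2 <= 1 / 3 ->
  \sum_(j < n.+1) (k ^+ j * d j) ^+ 2 <=
  4 * (d 0%N ^+ 2 + \sum_(j < n) (d j - d j.+1) ^+ 2).
Proof.
move=> k3.
(* The extra term carries the induction: [d n.+1 ^+ 2] is at most twice [d n ^+ 2] plus twice the
   squared increment, and [3 * k ^+ 2 <= 1]. *)
suff : \sum_(j < n.+1) (k ^+ j * d j) ^+ 2 + 2 * (k ^+ n * d n) ^+ 2 <=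
    4 * (d 0%N ^+ 2 + \sum_(j < n) (d j - d j.+1) ^+ 2).
  by apply: le_trans; rewrite lerDl mulr_ge0 ?sqr_ge0.
elim: n => [|n IHn].
  by rewrite big_ord_recr !big_ord0 /= expr0; have := sqr_ge0 (d 0%N); nra.
rewrite big_ord_recr /= [in leRHS]big_ord_recr /=.
set u := \sum_(_ < _) _ in IHn *; set v := \sum_(_ < n) _ in IHn *.
have k1 : (k ^+ n) ^+ 2 <= 1.
  by rewrite -exprM mulnC exprM exprn_ile1 ?sqr_ge0//; lra.
have k0 := sqr_ge0 (k ^+ n).
have step : 3 * (k ^+ n.+1 * d n.+1) ^+ 2 <=
    2 * (k ^+ n * d n) ^+ 2 + 4 * (d n - d n.+1) ^+ 2.
  have -> : 3 * (k ^+ n.+1 * d n.+1) ^+ 2 =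
    (3 * k ^+ 2) * ((k ^+ n) ^+ 2 * d n.+1 ^+ 2) by rewrite (exprS k n); ring.
  have h1 : (3 * k ^+ 2) * ((k ^+ n) ^+ 2 * d n.+1 ^+ 2) <=
      (k ^+ n) ^+ 2 * d n.+1 ^+ 2.
    by rewrite ler_piMl -?exprMn ?sqr_ge0//; lra.
  have h2 : (k ^+ n) ^+ 2 * (d n - d n.+1) ^+ 2 <= (d n - d n.+1) ^+ 2.
    by rewrite ler_piMl ?sqr_ge0.
  have h3 : (k ^+ n) ^+ 2 * d n.+1 ^+ 2 <=
     (k ^+ n) ^+ 2 * (2 * d n ^+ 2 + 2 * (d n - d n.+1) ^+ 2).
    rewrite ler_wpM2l//; have := sqr_ge0 (2 * d n - d n.+1); nra.
  have h4 := sqr_ge0 (d n - d n.+1).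
  by rewrite exprMn; nra.
by lra.
Qed.

(* Single fluxes are not small uniformly in time, but their sum over all modes
   is bounded, so averaging the energy balances over [n < N] removes them. *)
Lemma sum_flux_le {R : realType} (c : nat -> R) (B : R) (N : nat) :
    (forall n, \sum_(j < n) c j ^+ 2 <= B) ->
  \sum_(n < N) flux c n <= (5 + 2 * B) * B.
Proof.
move=> cB.
have B0 : 0 <= B by have := cB 0%N; rewrite big_ord0.
(* A lower bound on [c] suffices: it turns the cubic term of the flux into a multiple of
   [c n ^+ 2]. *)
have cj n : - c n <= B + 1.
  have := cB n.+1; rewrite big_ord_recr /= => h.
  have : 0 <= \sum_(j < n) c j ^+ 2 by apply: sumr_ge0 => *; rewrite sqr_ge0.
  nra.
apply: (@le_trans _ _ (\sum_(n < N) ((4 + 2 * B) * c n ^+ 2 + c n.+1 ^+ 2))).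
  apply: ler_sum => n _; rewrite /flux.
  have h1 : c n ^+ 2 * - c n.+1 <= c n ^+ 2 * (B + 1).
    by rewrite ler_wpM2l ?sqr_ge0.
  have h2 := sqr_ge0 (c n - c n.+1).
  nra.
rewrite big_split /= -mulr_sumr.
have h1 := cB N.
have h2 : \sum_(n < N) c n.+1 ^+ 2 <= B.
  apply: le_trans (cB N.+1); rewrite big_ord_recl /= lerDr ?sqr_ge0//.
have h3 : (4 + 2 * B) * \sum_(n < N) c n ^+ 2 <= (4 + 2 * B) * B.
  by rewrite ler_wpM2l//; lra.
lra.
Qed.

(** Each of the [N] balances contributes its [- 1], giving [- N%:R], while the fluxes cost in total
    a constant independent of [N]. *)
Lemma sum_dyadic_le {R : realType} (k lam B : R) (f a : nat -> R) (N : nat) :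
    0 < k -> k ^+ 2 <= 1 / 3 ->
    lam * k ^+ 3 = 1 -> f 0%N = k -> (forall j, f j.+1 = 0) ->
    (forall n, \sum_(j < n) (k ^- j * a j) ^+ 2 <= B) ->
  \sum_(n < N) \sum_(j < n.+1) 2 * (a j - k ^+ j) * dyadic_rhs lam f a j <=
  k * ((5 + 2 * B) * B - N%:R -
       (\sum_(n < N) \sum_(j < n.+1) (a j - k ^+ j) ^+ 2) / 4).
Proof.
move=> k0 k3 lk f0 fS aB.
pose c j := k ^- j * a j.
have ac j : a j = k ^+ j * c j by rewrite /c mulVKf// expf_neq0// gt_eqF.
under eq_bigr do rewrite (energy_identity _ _ _ _ c)//.
rewrite -mulr_sumr ler_pM2l//.
apply: (@le_trans _ _ (\sum_(n < N)
   (flux c n + (- 1 - (\sum_(j < n.+1) (a j - k ^+ j) ^+ 2) / 4)))).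
  apply: ler_sum => n _.
  have := weighted_sum_le _ (fun j => c j - 1) n k3.
  rewrite (eq_bigr (fun j : 'I__ => (a j - k ^+ j) ^+ 2)); last first.
    by move=> j _; rewrite ac; congr (_ ^+ 2); ring.
  rewrite [X in _ <= 4 * (_ + X)](eq_bigr
    (fun j : 'I__ => (c j - c j.+1) ^+ 2)); last first.
    by move=> j _; congr (_ ^+ 2); ring.
  move=> h; lra.
rewrite big_split /= [X in _ + X]sumrB sumr_const card_ord -mulr_suml.
have := sum_flux_le c B N aB.
rewrite -mulNrn -[- 1 *+ N]mulr_natr; lra.
Qed.

(** * Decay in time and extinction of the perturbation *)

Lemma C1_nonneg_continuous {R : realType} (u : R -> R) :
  C1_nonneg u -> {within `[0, +oo[, continuous u}.
Proof.
move=> [v [_ dv dv0]]; apply/continuous_within_itvcyP; split.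
  move=> t; rewrite in_itv/= andbT => t0.
  apply/differentiable_continuous/derivable1_diffP.
  exact: (@ex_derive _ _ _ _ _ _ _ (dv t t0)).
have : u 0 + t * ((u t - u 0) / t) @[t --> 0^'+] --> u 0 + 0 * v 0.
  apply: cvgD; first exact: cvg_cst.
  by apply: cvgM => //; apply: cvg_at_right_filter; exact: cvg_id.
rewrite mul0r addr0; apply: cvg_trans; apply: near_eq_cvg.
near=> t.
have t0 : 0 < t by near: t; exact: nbhs_right_gt.
by rewrite mulrC divfK ?gt_eqF// addrC subrK.
Unshelve. all: by end_near. Qed.

(* The comparison function [m (s - k t / 2)^2] solves [z' = - k sqrt (m z)],
   and [sqrt (m z) <= m + z / 4]. *)
Lemma linear_decay {R : realType} (k s K m : R) (S dS : R -> R) :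
    0 < k -> 0 <= s -> 0 <= K -> 0 <= m ->
    {within `[0, +oo[, continuous S} ->
    (forall t : R, 0 < t -> is_derive t 1 S (dS t)) ->
    (forall t : R, 0 < t -> t < 2 * s / k -> dS t <= k * (K - m - S t / 4)) ->
    S 0 <= m * s ^+ 2 ->
  S (2 * s / k) <= 4 * K.
Proof.
move=> k0 s0 K0 m0 cS dSE dSle S0.
pose T := 2 * s / k; rewrite -/T in dSle *.
have T0 : 0 <= T by rewrite /T divr_ge0 ?mulr_ge0// ltW.
(* [4 * K] is the level at which [K] balances the damping, and the exponential in [V] is the
   integrating factor for the damping rate [k / 4]. *)
pose W (t : R) := S t - m * (s - k / 2 * t) ^+ 2 - 4 * K.
pose V (t : R) := expR (k / 4 * t) * W t.
have dV (t : R) : 0 < t -> is_derive t 1 V (expR (k / 4 * t) *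
    (dS t + m * k * (s - k / 2 * t) + k / 4 * W t)).
  move=> t0; have dSt := dSE t t0.
  have e1 : is_derive t 1 (fun x : R => expR (k / 4 * x))
      (expR (k / 4 * t) * (k / 4)).
    apply: is_derive1_comp.
    rewrite -[X in is_derive _ _ _ X]mulr1.
    exact: is_deriveZ.
  have e2 : is_derive t 1 (fun x : R => (s - k / 2 * x) ^+ 2)
      (- k * (s - k / 2 * t)).
    have h : is_derive t 1 (fun x : R => s - k / 2 * x) (- (k / 2)).
      rewrite -[X in is_derive _ _ _ X]add0r -[X in is_derive _ _ _ (_ - X)]mulr1.
      apply: is_deriveB; exact: is_deriveZ.
    rewrite -[fun x : R => _]/((fun x : R => s - k / 2 * x) ^+ 2).
    have h2 := is_deriveX 2 h; apply: (is_derive_eq h2).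
    by rewrite /GRing.scale /= expr1; field.
  have e3 : is_derive t 1 W (dS t - m * (- k * (s - k / 2 * t)) - 0).
    apply: is_deriveB; apply: is_deriveB; exact: is_deriveZ.
  have e4 := is_deriveM e1 e3; apply: (is_derive_eq e4).
  by rewrite /GRing.scale /=; ring.
have cV : {within `[0, +oo[, continuous V}.
  apply/subspace_continuousP => t t0.
  have cE : {for t, continuous (fun x => expR (k / 4 * x))}.
    by apply: continuous_comp; [exact: mulrl_continuous|exact: continuous_expR].
  have cz : {for t, continuous (fun x => (s - k / 2 * x) ^+ 2)}.
    apply: (@continuous_comp _ _ _ (fun x => s - k / 2 * x) (fun x => x ^+ 2));
      last exact: exprn_continuous.
    by apply: cvgB; [exact: cvg_cst|exact: mulrl_continuous].
  apply: cvgM; first exact: cvg_within_filter cE.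
  apply: cvgB; last exact: cvg_cst.
  apply: cvgB; first by move/subspace_continuousP : cS; exact.
  by apply: cvgM; [exact: cvg_cst|exact: cvg_within_filter cz].
have V_le : V T <= V 0.
  have V1 (x : R) : x \in `]0, T[%R -> derivable V x 1.
    rewrite in_itv/= => /andP[x0 _].
    exact: (@ex_derive _ _ _ _ _ _ _ (dV x x0)).
  have V2 (x : R) : x \in `]0, T[%R -> V^`()%classic x <= 0.
    rewrite in_itv/= => /andP[x0 xT].
    rewrite derive1E (@derive_val _ _ _ _ _ _ _ (dV x x0)).
    rewrite pmulr_rle0 ?expR_gt0// /W.
    (* With [r = s - k / 2 * x], the terms in [m] form the square [m * (r / 2 - 1) ^+ 2], up to sign
       and the factor [k]. *)
    rewrite (_ : _ + _ = (dS x - k * (K - m - S x / 4)) -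
      k * m * ((s - k / 2 * x) / 2 - 1) ^+ 2); last by field.
    rewrite subr_le0 (@le_trans _ _ 0)//; first by rewrite subr_le0 dSle.
    by rewrite mulr_ge0 ?sqr_ge0// mulr_ge0// ltW.
  have V3 : {within `[0, T], continuous V}.
    apply: continuous_subspaceW cV => t /=.
    by rewrite !in_itv/= andbT => /andP[].
  by apply: (ler0_derive1_le_cc V1 V2 V3); rewrite ?in_itv/= ?lexx ?T0.
have : V 0 <= 0 by rewrite /V mulr0 expR0 mul1r /W mulr0 subr0; lra.
move=> /(le_trans V_le); rewrite /V pmulr_rle0 ?expR_gt0// /W.
have -> : s - k / 2 * T = 0 by rewrite /T; field; rewrite gt_eqF.
by rewrite expr0n mulr0 subr0 subr_le0.
Qed.

Lemma eq0_le_invn {R : realType} (x K : R) :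
  0 <= x -> (forall n, n%:R * x <= K) -> x = 0.
Proof.
move=> x0 xK; apply/eqP; rewrite eq_le x0 andbT leNgt; apply/negP => x_gt0.
have K0 : 0 <= K by have := xK 0%N; rewrite mul0r.
have := archi_boundP (divr_ge0 K0 x0).
by rewrite ltr_pdivrMr// ltNge xK.
Qed.

(** The sum [S N] of the first [N] truncated energies starts below [N * s ^+ 2] and is at most
    [4 * K] at the final time, with [K] independent of [N]. As the energy of mode [j] enters [S N]
    about [N - j] times, it must vanish. *)
Lemma extinction {R : realType} (k lam s B : R) (f : nat -> R)
    (a : R -> nat -> R) :
    0 < k -> k ^+ 2 <= 1 / 3 ->
    lam * k ^+ 3 = 1 -> f 0%N = k -> (forall j, f j.+1 = 0) ->
    is_solution lam f a -> 0 <= s ->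
    (forall n, \sum_(j < n) (a 0 j - k ^+ j) ^+ 2 <= s ^+ 2) ->
    (forall t : R, 0 <= t -> t <= 2 * s / k ->
       forall n, \sum_(j < n) (k ^- j * a t j) ^+ 2 <= B) ->
  forall j, a (2 * s / k) j = k ^+ j.
Proof.
move=> k0 k3 lk f0 fS [_ aC1 aE] s0 as0 aB.
have T0 : 0 <= 2 * s / k by rewrite divr_ge0 ?mulr_ge0// ltW.
have B0 : 0 <= B by have := aB 0 (lexx 0) T0 0%N; rewrite big_ord0.
set K := (5 + 2 * B) * B.
have K0 : 0 <= K by rewrite mulr_ge0// addr_ge0// mulr_ge0.
have ca j : {within `[0, +oo[, continuous (fun t => a t j)}.
  exact/C1_nonneg_continuous/aC1.
pose y n t := \sum_(j < n) (a t j - k ^+ j) ^+ 2.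
pose S N t := \sum_(n < N) y n.+1 t.
have cy n : {within `[0, +oo[, continuous (y n)}.
  apply/subspace_continuousP => t t0.
  apply: cvg_big => [|j _]; first exact: add_continuous.
  have cb : a u j - k ^+ j @[u --> within `[0, +oo[ (nbhs t)] --> a t j - k ^+ j.
    by apply: cvgB; [move/subspace_continuousP : (ca j); exact|exact: cvg_cst].
  exact: (cvgM cb cb).
have cS N : {within `[0, +oo[, continuous (S N)}.
  apply/subspace_continuousP => t t0.
  apply: cvg_big => [|n _]; first exact: add_continuous.
  by move/subspace_continuousP : (cy n.+1); exact.
have dy n (t : R) : 0 < t -> is_derive t 1 (y n)
    (\sum_(j < n) 2 * (a t j - k ^+ j) * dyadic_rhs lam f (a t) j).
  move=> t0.
  have dj (j : 'I_n) : is_derive t 1 (fun t => (a t j - k ^+ j) ^+ 2)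
      (2 * (a t j - k ^+ j) * dyadic_rhs lam f (a t) j).
    have h1 := is_deriveB (aE j t t0) (is_derive_cst (k ^+ j) t (1 : R)).
    have h2 := is_deriveX 2 h1; apply: (is_derive_eq h2).
    by rewrite /GRing.scale /= subr0 expr1.
  have := is_derive_sum dj.
  by rewrite (_ : \sum_(j < n) _ = y n)// /y fct_sumE.
have dS N (t : R) : 0 < t -> is_derive t 1 (S N)
    (\sum_(n < N) \sum_(j < n.+1)
      2 * (a t j - k ^+ j) * dyadic_rhs lam f (a t) j).
  move=> t0.
  have := is_derive_sum (fun n : 'I_N => dy n.+1 t t0).
  by rewrite (_ : \sum_(n < N) _ = S N)// /S fct_sumE.
have S_le N : S N (2 * s / k) <= 4 * K.
  apply: (linear_decay _ _ _ N%:R _ _ k0 s0 K0 (ler0n R N) (cS N) (dS N)).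
    move=> t t0 tT; apply: sum_dyadic_le => //; apply: aB; exact: ltW.
  have : S N 0 <= \sum_(n < N) s ^+ 2 by apply: ler_sum => n _; exact: as0.
  by rewrite sumr_const card_ord mulr_natl.
move=> j; set T := 2 * s / k in S_le *.
suff /eqP : (a T j - k ^+ j) ^+ 2 = 0 by rewrite sqrf_eq0 subr_eq0 => /eqP.
apply: (eq0_le_invn _ (4 * K)); first exact: sqr_ge0.
(* Mode [j] occurs in exactly [M] of the truncated energies summed in [S (j + M)]. *)
move=> M; apply: le_trans (S_le (j + M)%N).
elim: M => [|M IHM].
  by rewrite mul0r; apply: sumr_ge0 => n _; apply: sumr_ge0 => *; exact: sqr_ge0.
rewrite addnS /S big_ord_recr /= -/(S _ _) -natr1 mulrDl mul1r lerD//.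
have jM : (j < (j + M).+1)%N by rewrite ltnS leq_addr.
rewrite /y (bigD1 (Ordinal jM))//= lerDl.
by apply: sumr_ge0 => *; exact: sqr_ge0.
Qed.

(** * Norms as bounds on partial sums, and the numerical constants *)

Lemma partial_sum_le_sqr {R : realType} (w : nat -> R) (M : R) (n : nat) :
    (forall j, 0 <= w j) ->
    ((\sum_(0 <= j <oo) (w j)%:E) `^ (2^-1) <= M%:E)%E ->
  \sum_(j < n) w j <= M ^+ 2.
Proof.
move=> w0; set x := (\sum_(0 <= j <oo) _)%E => xM.
have w0' j : (0 <= j)%N -> true -> (0 <= (w j)%:E)%E by rewrite lee_fin.
have x0 : (0 <= x)%E by exact: nneseries_ge0.
have nx : (\sum_(0 <= j < n) (w j)%:E <= x)%E by exact: nneseries_lim_ge.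
have M0 : 0 <= M by rewrite -lee_fin (le_trans _ xM)// poweR_ge0.
have xE : x = ((x `^ 2^-1) `^ 2)%E.
  by rewrite -poweRrM mulVf// poweRe1.
have : (x <= (M ^+ 2)%:E)%E.
  rewrite xE -powR_mulrn// -poweR_EFin; apply: gt0_ler_poweR => //.
    by rewrite in_itv/= poweR_ge0 leey.
  by rewrite in_itv/= lee_fin M0 leey.
by move=> /(le_trans nx); rewrite sumEFin lee_fin big_mkord.
Qed.

Lemma sqrt_series_lty {R : realType} (w : nat -> R) (C : R) :
    (forall j, 0 <= w j) -> (forall n, \sum_(j < n) w j <= C) ->
  ((\sum_(0 <= j <oo) (w j)%:E) `^ (2^-1) < +oo)%E.
Proof.
move=> w0 wC; apply: poweR_lty; apply: (@le_lt_trans _ _ C%:E); last exact: ltry.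
apply: lime_le; first by apply: is_cvg_nneseries => *; rewrite lee_fin.
by apply: nearW => n; rewrite sumEFin lee_fin big_mkord.
Qed.

Lemma powR_thirds {R : realType} (x : R) (j : nat) :
  x `^ (- (j%:R / 3)) = (x `^ (- (1 / 3))) ^+ j.
Proof.
rewrite -[RHS]powR_mulrn; last exact: powR_ge0.
by rewrite -[RHS]powRrM; congr (_ `^ _); field.
Qed.

Lemma sqr_lambda {R : realType} : lambda R ^+ 2 = 32.
Proof.
rewrite -powR_mulrn; last exact: powR_ge0.
rewrite -powRrM (_ : 5 / 2 * 2%:R = 5%:R); last by field.
by rewrite powR_mulrn//; ring.
Qed.

Lemma lambda_thirds3 {R : realType} :
  lambda R * (lambda R `^ (- (1 / 3))) ^+ 3 = 1.
Proof.
have lambda_gt0 : 0 < lambda R by exact: powR_gt0.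
rewrite -powR_thirds divff// powRN powRr1; last exact: ltW.
by rewrite divff// gt_eqF.
Qed.

(** The cube of the left side is [1 / 32], because [lambda ^+ 2 = 32], and this is below
    [1 / 27]. *)
Lemma sqr_lambda_thirds_le {R : realType} :
  (lambda R `^ (- (1 / 3))) ^+ 2 <= 1 / 3.
Proof.
set k := lambda R `^ _.
have : 32 * (k ^+ 2) ^+ 3 = 1.
  by rewrite -sqr_lambda -exprM mulnC exprM -exprMn lambda_thirds3 expr1n.
have := sqr_ge0 k; move: (k ^+ 2) => r r0 rE.
rewrite leNgt; apply/negP => r3.
have : (1 / 3) ^+ 3 <= r ^+ 3 by rewrite lerXn2r ?nnegrE//; lra.
rewrite !exprS expr0; lra.
Qed.

(** The exponent 5/6 is the critical one: [2 ^ (5 / 3)] equals [lambda ^ (2 / 3)], so the weights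
    are the powers of [k ^- 2]. *)
Lemma H56_weightE {R : realType} (j : nat) (x : R) :
  2 `^ (2 * (5 / 6) * j%:R) * x ^+ 2 =
  ((lambda R `^ (- (1 / 3))) ^- j * x) ^+ 2.
Proof.
rewrite exprMn -powR_thirds -powRN opprK; congr (_ * _).
rewrite -[RHS]powR_mulrn; last exact: powR_ge0.
by rewrite /lambda -!powRrM; congr (_ `^ _); field.
Qed.

Lemma sum_geometric_le {R : realType} (r : R) (n : nat) :
  0 <= r -> r <= 1 / 3 -> \sum_(j < n) r ^+ j <= 3 / 2.
Proof.
move=> r0 r3; suff : \sum_(j < n) r ^+ j + 3 / 2 * r ^+ n <= 3 / 2.
  by apply: le_trans; rewrite lerDl mulr_ge0 ?exprn_ge0.
elim: n => [|n IHn]; first by rewrite big_ord0 expr0 add0r mulr1.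
rewrite big_ord_recr /= exprS; have := exprn_ge0 n r0; nra.
Qed.

(** * From finite limsups to a uniform bound *)

Lemma limsup_lty_near {R : realType} (g : R -> \bar R) (t : R) :
  limsup_nonneg g t != +oo%E ->
  exists M : R, \forall u \near t, u != t -> 0 <= u -> (g u <= M%:E)%E.
Proof.
rewrite -ltey => /ereal_inf_lt[_ [V tV <-]] supV.
have [M supM] : exists M : R, (ereal_sup (g @` V) <= M%:E)%E.
  case: ereal_sup supV => [r _||] //; first by exists r.
  by exists 0; rewrite leNye.
have tV' : nbhs t [set u | u != t -> `[0, +oo[%classic u -> V u] := tV.
exists M; apply: filterS tV' => u Vu ut u0.
apply: le_trans supM; apply: ereal_sup_ubound; exists u => //.
by apply: Vu => //=; rewrite in_itv/= andbT.
Qed.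

(** The limsup ignores the time [t] itself. Each partial sum is continuous, so its bound passes to
    [t] in the limit; the limit is taken from the right because [t] may be 0. *)
Lemma locally_bounded_sums {R : realType} (w : R -> nat -> R) (t : R) :
    0 <= t ->
    (forall j, {within `[0, +oo[, continuous (w ^~ j)}) ->
    (exists B : R, \forall u \near t, u != t -> 0 <= u ->
       forall n, \sum_(j < n) w u j <= B) ->
  exists B : R, \forall u \near t, 0 <= u -> forall n, \sum_(j < n) w u j <= B.
Proof.
move=> t0 cw [B wB]; exists B; apply: filterS (wB) => u.
have [-> _ _ n|ut] := eqVneq u t; last by move=> /(_ isT).
have ct : \sum_(j < n) w u j @[u --> t^'+] --> \sum_(j < n) w t j.
  apply: cvg_big => [|j _]; first exact: add_continuous.
  have [_ cj0] := (continuous_within_itvcyP _ _).1 (cw j).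
  have [cj _] := (continuous_within_itvcyP _ _).1 (cw j).
  move: t0; rewrite le_eqVlt => /predU1P[<-//|t0].
  by apply: cvg_at_right_filter; apply: cj; rewrite in_itv/= t0.
apply: cvgr_to_le ct _; near=> v.
have tv : t < v by near: v; exact: nbhs_right_gt.
have : v != t -> 0 <= v -> forall n, \sum_(j < n) w v j <= B.
  by near: v; apply: cvg_within; exact: wB.
by apply; rewrite ?gt_eqF// (le_trans t0)// ltW.
Unshelve. all: by end_near. Qed.

Lemma uniformly_bounded_sums {R : realType} (w : R -> nat -> R) (T : R) :
    (forall t, 0 <= t -> t <= T -> exists B : R,
       \forall u \near t, 0 <= u -> forall n, \sum_(j < n) w u j <= B) ->
  exists B : R, forall t, 0 <= t -> t <= T ->
    forall n, \sum_(j < n) w t j <= B.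
Proof.
move=> wB; have /compact_near_coveringP cT := @segment_compact _ 0 T.
pose P (B u : R) := 0 <= u -> forall n, \sum_(j < n) w u j <= B.
(* Bounds may only be enlarged, so compactness is applied to the filter of [B] tending to infinity,
   which yields a common bound without extracting a finite subcover. *)
have : \forall B \near +oo, `[0, T]%classic `<=` P B.
  apply: cT => t; rewrite /= in_itv/= => /andP[t0 tT].
  have [B tB] := wB t t0 tT.
  exists (P B, [set C | B <= C]) => /=.
    by split => //; exact: nbhs_pinfty_ge (num_real B).
  by move=> [u C] /= [uB BC] u0 n; apply: le_trans BC; exact: uB.
move=> /filter_ex[B BP]; exists B => t t0 tT.
by apply: BP => //=; rewrite in_itv/= t0 tT.
Qed.

(** * Contradiction at the extinction time *)

Theorem theorem5p2 (R : realType) (a : R -> nat -> R)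
  (ha : is_solution (lambda R) (@forcing R) a) (ha0 : in_l2 (a 0)) :
  exists tstar : R,
    [/\ 0 <= tstar,
        (tstar%:E <= (2 * lambda R `^ (1 / 3))%:E *
           l2norm (fun j : nat => (a 0 j - lambda R `^ (- (j%:R / 3)))%R))%E &
        limsup_nonneg (fun t => Hnorm (5 / 6) (a t)) tstar = +oo%E].
Proof.
pose k := lambda R `^ (- (1 / 3)).
have k0 : 0 < k by rewrite !powR_gt0.
have k3 : k ^+ 2 <= 1 / 3 := sqr_lambda_thirds_le.
pose b (j : nat) := a 0 j - k ^+ j.
have -> : (fun j : nat => a 0 j - lambda R `^ (- (j%:R / 3))) = b.
  by apply/funext => j; rewrite powR_thirds.
have -> : lambda R `^ (1 / 3) = k^-1 by rewrite /k powRN invrK.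
have [s s0 bs] : exists2 s, 0 <= s & l2norm b = s%:E.
  have [M aM] : exists M : R, (l2norm (a 0%R) <= M%:E)%E.
    exists (fine (l2norm (a 0))); rewrite fineK// ge0_fin_numE//.
    exact: poweR_ge0.
  have : (l2norm b < +oo)%E.
    (* The bound comes from [(x - y) ^+ 2 <= 2 * x ^+ 2 + 2 * y ^+ 2], with [3 / 2] for the
       geometric series of ratio [k ^+ 2]. *)
    apply: (sqrt_series_lty (fun j => b j ^+ 2) (2 * M ^+ 2 + 2 * (3 / 2)))
      => [j|n].
      exact: sqr_ge0.
    apply: (@le_trans _ _
        (\sum_(j < n) (2 * a 0 j ^+ 2 + 2 * (k ^+ 2) ^+ j))).
      apply: ler_sum => j _; rewrite /b -exprM mulnC exprM.
      by have := sqr_ge0 (a 0 j + k ^+ j); nra.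
    rewrite big_split /= -!mulr_sumr; apply: lerD; rewrite ler_pM2l//.
      apply: (partial_sum_le_sqr (fun j => a 0 j ^+ 2)) => // j.
      exact: sqr_ge0.
    by apply: sum_geometric_le => //; exact: sqr_ge0.
  have : (0 <= l2norm b)%E by exact: poweR_ge0.
  by case: (l2norm b) => // s s0 _; exists s.
rewrite bs -EFinM mulrAC; set T := 2 * s / k.
apply: contrapT => no_blowup.
pose w t j := (k ^- j * a t j) ^+ 2.
have cw j : {within `[0, +oo[, continuous (w ^~ j)}.
  have ca : {within `[0, +oo[, continuous (a ^~ j)}.
    by case: ha => _ + _ => /(_ j)/C1_nonneg_continuous.
  apply/subspace_continuousP => t t0.
  have cj : k ^- j * a u j @[u --> within `[0, +oo[ (nbhs t)] -->
      k ^- j * a t j.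
    by apply: cvgM; [exact: cvg_cst|move/subspace_continuousP : ca; exact].
  exact: (cvgM cj cj).
have [B wB] : exists B : R, forall t, 0 <= t -> t <= T ->
    forall n, \sum_(j < n) w t j <= B.
  apply: uniformly_bounded_sums => t t0 tT; apply: locally_bounded_sums => //.
  have /limsup_lty_near[M HM] :
      limsup_nonneg (fun t => Hnorm (5 / 6) (a t)) t != +oo%E.
    by apply/eqP => tblow; apply: no_blowup; exists t; rewrite lee_fin.
  exists (M ^+ 2); apply: filterS HM => u uM ut u0 n.
  apply: partial_sum_le_sqr => [j|]; first exact: sqr_ge0.
  have := uM ut u0; rewrite /Hnorm.
  by under eq_eseriesr do rewrite H56_weightE.
have aT : forall j, a T j = k ^+ j.
  apply: (extinction _ (lambda R) s B (@forcing R) a) => //.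
    exact: lambda_thirds3.
  move=> n; apply: (partial_sum_le_sqr (fun j => b j ^+ 2)) => [j|].
    exact: sqr_ge0.
  by rewrite -/(l2norm b) bs.
have T0 : 0 <= T by rewrite /T divr_ge0 ?mulr_ge0// ltW.
(* At time [T] every weighted square equals 1, so the partial sums are the integers [n], which the
   uniform bound [B] cannot dominate. *)
have nB n : n%:R <= B.
  have := wB T T0 (lexx T) n; rewrite (eq_bigr (fun=> 1)).
    by rewrite sumr_const card_ord.
  by move=> j _; rewrite /w aT mulVf ?expr1n// expf_neq0// gt_eqF.
have B0 := nB 0%N.
by have := archi_boundP B0; rewrite ltNge nB.
Qed.
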